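(* Let $q\ge 3$ be a prime power, let $m\ge 2$ and let $n$ be an odd positive integer. Let $\operatorname{TSRP}(m,n,q)$ be the set of primitive transformation shift register matrices of order $n$ over $\mathbb{F}_{q^m}$ (defined in the context), and let $\Psi_P(\operatorname{TSRP}(m,n,q))=\{\det(XI_{mn}-T): T\in \operatorname{TSRP}(m,n,q)\}$ be the set of their characteristic polynomials. Then $$\left|\operatorname{TSRP}(m,n,q)\right| = \left|\Psi_P\left(\operatorname{TSRP}(m,n,q)\right)\right| \prod_{i=1}^{m-1}(q^m-q^i).$$
   Context: A polynomial of degree $d$ over a finite field $\mathbb{F}_Q$ is primitive if it is monic and irreducible and one (equivalently every) root generates the cyclic group $\mathbb{F}_{Q^d}^*$. A TSR matrix of order $n$ over $\mathbb{F}_{q^m}$ is an $mn\times mn$ block matrix over $\mathbb{F}_q$ with $m\times m$ blocks of the form $$T=\begin{pmatrix} \mathbf{0} & \mathbf{0} & \cdots & \mathbf{0} & c_0A\\ I_m & \mathbf{0} & \cdots & \mathbf{0} & c_1A\\ \mathbf{0} & I_m & \cdots & \mathbf{0} & c_2A\\ \vdots & & \ddots & & \vdots\\ \mathbf{0} & \mathbf{0} & \cdots & I_m & c_{n-1}A\end{pmatrix},$$ where $c_0,\dots,c_{n-1}\in\mathbb{F}_q$, $A\in M_m(\mathbb{F}_q)$, $I_m$ is the identity and $\mathbf{0}$ the zero $m\times m$ matrix. Such a $T$ is called primitive if its characteristic polynomial $\det(XI_{mn}-T)\in\mathbb{F}_q[X]$ is a primitive polynomial (of degree $mn$) over $\mathbb{F}_q$.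 $\operatorname{TSRP}(m,n,q)$ denotes the set of all primitive TSR matrices of order $n$ over $\mathbb{F}_{q^m}$. *)

(* Defs.v *)
From mathcomp Require Import all_boot all_algebra all_field finmap.

Set Implicit Arguments.
Unset Strict Implicit.
Unset Printing Implicit Defensive.

Import GRing.Theory.
Local Open Scope ring_scope.

(* Primitivity of polynomials is the library's [primitive_poly], which speaks of
   the order of 'X modulo p. For a monic irreducible p of degree d over F, this
   is the statement that a root of p generates the multiplicative group of the
   field with #|F| ^ d elements; the root [a] is arbitrary, so one root is a
   generator iff all are. *)
Lemma primitive_poly_root (F L : finFieldType) (iota : {rmorphism F -> L})
    (p : {poly F}) (a : L) :
  p \is monic -> irreducible_poly p -> #|L| = (#|F| ^ (size p).-1)%N ->
  root (map_poly iota p) a ->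
  primitive_poly p <-> a != 0 /\ (forall y, y != 0 -> exists k, y = a ^+ k).
Proof.
move=> pM pI cL ra.
have cQ : #|{poly %/ p}| = #|L| by rewrite card_monic_qpoly ?cL //; case: pI.
have L1 : (1 < #|L|)%N by exact: finNzRing_gt1.
have v_gt0 : (0 < #|L|.-1)%N by rewrite -subn1 subn_gt0.
have dvE n : (p %| 'X^n - 1) = (a ^+ n == 1).
  apply/idP/eqP => [pd|an1].
    have : root (map_poly iota ('X^n - 1)) a.
      by apply: root_dvdp ra; rewrite dvdp_map.
    by rewrite rmorphB rmorph1 /= map_polyXn rootE !hornerE subr_eq0 => /eqP.
  rewrite -[_ %| _]negbK -irreducible_poly_coprime //; apply/negP.
  rewrite -(coprimep_map iota) => /coprimep_root/(_ ra).
  by rewrite rmorphB rmorph1 /= map_polyXn !hornerE an1 subrr eqxx.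
have order_le n : (0 < n)%N -> a != 0 -> a ^+ n = 1 ->
    (forall y, y != 0 -> exists k, y = a ^+ k) -> (#|L|.-1 <= n)%N.
  move=> n0 a0 an1 gen.
  have -> : #|L|.-1 = #|predC1 (0 : L)| by rewrite cardC1.
  pose s := [seq a ^+ (i : 'I_n) | i <- enum 'I_n].
  have <- : size s = n by rewrite size_map -cardE card_ord.
  apply: leq_trans (card_size s); apply/subset_leq_card/subsetP => y /= y0.
  have [k ->] := gen y y0; apply/mapP; exists (Ordinal (ltn_pmod k n0)).
    by rewrite mem_enum.
  by rewrite /= {1}(divn_eq k n) exprD mulnC exprM an1 expr1n mul1r.
have aq : a != 0 -> a ^+ #|L|.-1 = 1.
  move=> a0; apply: (mulfI a0); rewrite -exprS prednK ?mulr1 1?ltnW //.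
  exact: expf_card.
split=> [/primitive_polyP/= [_]|[a0 gen]].
  rewrite cQ dvE => /eqP av min.
  have prim : (#|L|.-1).-primitive_root a.
    have [d dP dd] := prim_order_exists v_gt0 av.
    have := min d; rewrite dvE (prim_expr_order dP) eqxx /=.
    rewrite (prim_order_gt0 dP) /= => /implyP; rewrite implybF -leqNgt => vd.
    suff -> : #|L|.-1 = d by [].
    by apply/eqP; rewrite eqn_leq vd dvdn_leq.
  have a0 : a != 0.
    apply/eqP => a0; move/eqP: av.
    by rewrite a0 expr0n eqn0Ngt v_gt0 eq_sym oner_eq0.
  split=> // y y0.
  have : y ^+ #|L|.-1 = 1.
    apply: (mulfI y0); rewrite -exprS prednK ?mulr1 1?ltnW //; exact: expf_card.
  by case/(prim_rootP prim) => i ->; exists i.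
apply/primitive_polyP; rewrite /= cQ; split=> [//||n /andP[n0 nv]].
  by rewrite dvE aq.
rewrite dvE; apply/eqP => an1.
by have := order_le n n0 a0 an1 gen; rewrite leqNgt nv.
Qed.

(* [\sum_(i < n) m] is the dimension n * m in the form imposed by \mxblock. *)
Definition tsr_mx (F : finFieldType) (m n : nat) (c : {ffun 'I_n -> F})
    (A : 'M[F]_m) : 'M[F]_(\sum_(i < n) m) :=
  \mxblock_(i < n, j < n)
     (if j.+1 == n then c i *: A
      else if i == j.+1 :> nat then 1%:M else 0 : 'M[F]_m).

Definition is_tsr_mx (F : finFieldType) (m n : nat)
    (T : 'M[F]_(\sum_(i < n) m)) : bool :=
  [exists c : {ffun 'I_n -> F}, exists A : 'M[F]_m, T == tsr_mx c A].

Definition TSRP (m n : nat) (F : finFieldType) : {set 'M[F]_(\sum_(i < n) m)} :=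
  [set T | is_tsr_mx T && primitive_poly (char_poly T)].

Definition PsiP (F : finFieldType) (N : nat) (S : {set 'M[F]_N}) :
    {fset {poly F}} :=
  [fset char_poly T | T in S]%fset.

(* Main.v *)
Require Import Defs.
From mathcomp Require Import all_boot all_algebra all_field finmap.

(* Absorbing c_0 (nonzero, since T is invertible) into A, one may assume c_0 = 1;
   write g = \sum_i c_i X^i.  If z is a root of the irreducible characteristic
   polynomial of T, a left eigenvector of T for z has the form
   (w, z w, ..., z^(n-1) w) with g(z) w A = z^n w, so b = z^n / g(z) is an
   eigenvalue of A.  Comparing degrees in F < F(b) < F(z), the minimal polynomial
   of b over F is the characteristic polynomial of A, and that of z over F(b) is
   X^n - b g.  As F(b) is the only subfield of F(z) of its size, z determines b
   (from the constant coefficient) and then g.  Hence the primitive T with a given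
   characteristic polynomial correspond to the matrices A with a given irreducible
   characteristic polynomial f, which are counted through the bijection
   Q |-> (v0 Q, Q^-1 A0 Q) from GL_m to the pairs (v, A) with v != 0 and
   char_poly A = f; its inverse is built from the bases v, v A, v A^2, ... *)

Set Implicit Arguments.
Unset Strict Implicit.
Unset Printing Implicit Defensive.

Import GRing.Theory.
Local Open Scope ring_scope.

(** * Matrices with irreducible characteristic polynomial: Krylov bases, conjugacy, counting *)

Lemma char_poly_conj (F : fieldType) n (P A B : 'M[F]_n) :
  P \in unitmx -> P *m A = B *m P -> char_poly A = char_poly B.
Proof.
move=> Pu PA.
have dP : \det P != 0 by rewrite -unitfE -unitmxE.
apply: (@mulfI _ (\det (map_mx polyC P))).
  by rewrite det_map_mx polyC_eq0.
rewrite /char_poly [RHS]mulrC -!det_mulmx /char_poly_mx mulmxBl mulmxBr.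
by rewrite -!map_mxM PA scalar_mxC.
Qed.

Definition krylov_mx (F : fieldType) n (A : 'M[F]_n.+1) (v : 'rV[F]_n.+1) :=
  \matrix_(i < n.+1) (v *m A ^+ i).

Lemma mul_rVpoly_krylov (F : fieldType) n (A : 'M[F]_n.+1) (v u : 'rV[F]_n.+1) :
  u *m krylov_mx A v = v *m horner_mx A (rVpoly u).
Proof.
rewrite mulmx_sum_row horner_rVpoly [u *m powers_mx _ _]mulmx_sum_row.
rewrite !linear_sum /=; apply: eq_bigr => i _.
by rewrite !rowK !linearZ /= mxvecK.
Qed.

(** A kernel vector is a nonzero polynomial [p] of degree below that of [char_poly A] with
    [v *m p(A) = 0]. It is coprime to [char_poly A], so Bezout and Cayley-Hamilton make [p(A)]
    invertible, whence [v = 0]. *)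
Lemma krylov_mx_unit (F : fieldType) n (A : 'M[F]_n.+1) (v : 'rV[F]_n.+1) :
  irreducible_poly (char_poly A) -> v != 0 -> krylov_mx A v \in unitmx.
Proof.
move=> irrA v0; rewrite unitmxE unitfE; apply/det0P=> -[u u0].
rewrite mul_rVpoly_krylov => vu0.
have : coprimep (char_poly A) (rVpoly u).
  rewrite irreducible_poly_coprime // gtNdvdp ?size_char_poly ?ltnS ?size_poly //.
  by apply: contra u0 => /eqP ru; rewrite -[u]rVpolyK ru linear0.
case/Bezout_eq1_coprimepP=> -[a b] /= /(congr1 (horner_mx A)).
rewrite rmorphD !rmorphM rmorph1 /= Cayley_Hamilton mulr0 add0r => E.
case/negP: v0; rewrite -[v]mulmx1 -[1%:M]/(1 : 'M_n.+1) -E.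
have -> : horner_mx A b * horner_mx A (rVpoly u) =
          horner_mx A (rVpoly u) *m horner_mx A b by rewrite -!mulmxE; exact: comm_horner_mx2.
by rewrite mulmxA vu0 mul0mx.
Qed.

(** On the Krylov rows [A] acts as a companion matrix, which depends on [char_poly A] alone. *)
Lemma krylov_mx_mul (F : fieldType) n (A : 'M[F]_n.+1) (v : 'rV[F]_n.+1) :
  krylov_mx A v *m A =
  (\matrix_(i < n.+1) poly_rV ('X^(i.+1) %% char_poly A)) *m krylov_mx A v.
Proof.
apply/row_matrixP => i; rewrite !row_mul !rowK mul_rVpoly_krylov.
have szA := size_char_poly A.
have f0 : char_poly A != 0 by rewrite -size_poly_eq0 szA.
rewrite poly_rV_K; last by rewrite -ltnS -szA ltn_modp.
rewrite -mulmxA; congr (_ *m _).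
have := congr1 (horner_mx A) (divp_eq 'X^(i.+1) (char_poly A)).
rewrite rmorphD rmorphM /= Cayley_Hamilton mulr0 add0r => <-.
by rewrite rmorphXn /= horner_mx_X exprSr mulmxE.
Qed.

(** Both matrices become the same companion matrix in their Krylov bases, so the change of basis
    conjugates them; it maps [w] to [v] because these are the first basis vectors. *)
Lemma char_poly_eq_conj (F : fieldType) n (A B : 'M[F]_n.+1)
    (v w : 'rV[F]_n.+1) :
  irreducible_poly (char_poly B) -> char_poly A = char_poly B ->
  v != 0 -> w != 0 ->
  exists Q, [/\ Q \in unitmx, w *m Q = v & Q *m A = B *m Q].
Proof.
move=> irr fAB v0 w0.
have Kw := krylov_mx_unit irr w0.
have Kv : krylov_mx A v \in unitmx by apply: krylov_mx_unit; rewrite ?fAB.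
exists (invmx (krylov_mx B w) *m krylov_mx A v); split.
- by rewrite unitmx_mul unitmx_inv Kw.
- have row0 C u : row 0 (krylov_mx C u) = u :> 'rV[F]_n.+1 by rewrite rowK mulmx1.
  by rewrite -[X in X *m _](row0 B w) -row_mul mulKVmx.
rewrite -[LHS]mulmxA krylov_mx_mul fAB !mulmxA; congr (_ *m _).
apply: (can_inj (mulmxK Kw)); rewrite -mulmxA -krylov_mx_mul.
by rewrite mulKmx // mulmxKV.
Qed.

Lemma card_unitmx (F : finFieldType) n :
  #|[set P : 'M[F]_n.+1 | P \in unitmx]| =
  (\prod_(i < n.+1) (#|F| ^ n.+1 - #|F| ^ i))%N.
Proof.
transitivity #|'GL_(n.+1)[F]%g|.
  by rewrite cardsE cardsT card_sub; apply: eq_card => A; rewrite !inE.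
rewrite card_GL //.
(* The power of [#|F|] in the order of GL is spread as one factor [#|F| ^ i] per index, to be paired
   with the remaining product in reverse order. *)
rewrite -bin2_sum expn_sum big_mkord.
rewrite big_add1 /= big_mkord [X in (_ * X)%N](reindex_inj rev_ord_inj) /=.
rewrite -big_split /=.
apply: eq_bigr => i _; rewrite subSS.
rewrite [LHS]mulnBr muln1 -expnD; congr (_ ^ _ - _)%N.
by rewrite addnS subnKC -1?ltnS.
Qed.

Lemma card_char_poly_class (F : finFieldType) m (A0 : 'M[F]_m) :
  irreducible_poly (char_poly A0) ->
  #|[set A : 'M[F]_m | char_poly A == char_poly A0]| =
  (\prod_(1 <= i < m) (#|F| ^ m - #|F| ^ i))%N.
Proof.
case: m A0 => [|m] A0 irr.
  by case: irr; rewrite size_char_poly.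
set q := #|F|; set S := [set A | _].
have q1 : (1 < q)%N by exact: finNzRing_gt1.
have pos : (0 < q ^ m.+1 - 1)%N by rewrite subn_gt0 -(exp1n m.+1) ltn_exp2r.
(* The factor for [i = 0] completes the product to the order of GL; it counts the nonzero row
   vectors. *)
apply/eqP; rewrite -(eqn_pmul2l pos); apply/eqP.
transitivity (\prod_(i < m.+1) (q ^ m.+1 - q ^ i))%N; last first.
  by rewrite -(big_mkord xpredT (fun i => q ^ m.+1 - q ^ i)%N) big_ltn.
rewrite -card_unitmx.
have -> : (q ^ m.+1 - 1)%N = #|[set v : 'rV[F]_m.+1 | v != 0]|.
  have -> : [set v : 'rV[F]_m.+1 | v != 0] = [set~ 0] by apply/setP=> v; rewrite !inE.
  by rewrite cardsC1 card_mx mul1n subn1.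
pose v0 : 'rV[F]_m.+1 := const_mx 1.
have v0n : v0 != 0.
  by apply/eqP => /rowP/(_ ord0)/eqP; rewrite !mxE oner_eq0.
pose h (Q : 'M[F]_m.+1) := (v0 *m Q, invmx Q *m A0 *m Q).
have QA (Q : 'M[F]_m.+1) : Q \in unitmx -> Q *m (h Q).2 = A0 *m Q.
  by move=> Qu; rewrite /= !mulmxA mulmxV // mul1mx.
(* This recovers [Q] from [h Q], since the Krylov matrix of [A0] and [v0] is invertible: [h] is
   injective on units. *)
have Qk (Q : 'M[F]_m.+1) : Q \in unitmx ->
    krylov_mx A0 v0 *m Q = krylov_mx (h Q).2 (h Q).1.
  move=> Qu; apply/row_matrixP => i; rewrite row_mul !rowK -!mulmxA.
  congr (_ *m _); elim: (i : nat) => [|k IHk]; first by rewrite mulmx1 mul1mx.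
  by rewrite !exprSr -mulmxA -QA // mulmxA IHk -mulmxA mulmxE.
have K0u := krylov_mx_unit irr v0n.
rewrite -cardsX -(card_in_imset (f := h)) => [|Q Q']; last first.
  rewrite !inE => Qu Q'u hQ.
  by apply: (can_inj (mulKmx K0u)); rewrite !Qk // hQ.
congr #|pred_of_set _|; apply/setP => -[v A]; rewrite !inE /=.
apply/andP/imsetP => [[vn /eqP fA]|[Q]]; last first.
  rewrite inE => Qu [-> ->]; split.
    apply: contra v0n => /eqP vQ.
    by rewrite -[v0](mulmxK Qu) vQ mul0mx.
  by apply/eqP; apply: (char_poly_conj Qu); exact: QA.
have [Q [Qu <- QAE]] := char_poly_eq_conj irr fA vn v0n.
exists Q; rewrite ?inE //; congr (_, _).
by apply: (can_inj (mulKmx Qu)); rewrite QAE !mulmxA mulmxV // mul1mx.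
Qed.

(** * TSR matrices: rescaling, conjugation and eigenvectors *)

Lemma tsr_mx_scale (F : finFieldType) m n (a : F) (c : {ffun 'I_n -> F})
    (A : 'M[F]_m) :
  a != 0 -> tsr_mx [ffun i => c i / a] (a *: A) = tsr_mx c A.
Proof.
move=> a0; apply/eq_mxblock => i j.
by rewrite ffunE scalerA mulfVK.
Qed.

(** The block diagonal matrix with [P] in every block commutes with the identity blocks and
    conjugates the last block column. *)
Lemma char_poly_tsr_conj (F : finFieldType) m n (c : {ffun 'I_n -> F})
    (P A B : 'M[F]_m) :
  P \in unitmx -> P *m A = B *m P ->
  char_poly (tsr_mx c A) = char_poly (tsr_mx c B).
Proof.
move=> Pu PA; pose D := \mxdiag_(i < n) P.
apply: (@char_poly_conj _ _ D).
  have : D *m \mxdiag_(i < n) (invmx P) = 1%:M.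
    rewrite mul_mxdiag_mxblock -mxdiagZ; apply/eq_mxblock => i j.
    by case: ifP; rewrite ?mulmx0 // !conform_mx_id mulmxV.
  by case/mulmx1_unit.
rewrite mul_mxdiag_mxblock mul_mxblock_mxdiag; apply/eq_mxblock => i j.
case: ifP => _; first by rewrite -scalemxAl -scalemxAr PA.
by case: ifP => _; rewrite ?mulmx1 ?mul1mx ?mulmx0 ?mul0mx.
Qed.

Section Eigen.
Variables (F : finFieldType) (L : fieldType) (iota : {rmorphism F -> L}).
Variables (m n : nat) (c : {ffun 'I_n.+1 -> F}) (A : 'M[F]_m).

Lemma map_tsr_mx : map_mx iota (tsr_mx c A) =
  \mxblock_(i < n.+1, j < n.+1)
     (if j.+1 == n.+1 then iota (c i) *: map_mx iota A
      else if i == j.+1 :> nat then 1%:M else 0 : 'M[L]_m).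
Proof.
apply/matrixP => i j; rewrite !mxE.
case: ifP => _; rewrite ?mxE ?rmorphM //.
by case: ifP => _; rewrite !mxE ?rmorph0 ?rmorph_nat.
Qed.

Lemma tsr_mx_eigen (a : L) :
  root (map_poly iota (char_poly (tsr_mx c A))) a ->
  exists2 w : 'rV[L]_m, w != 0 &
    (\sum_i iota (c i) * a ^+ i) *: (w *m map_mx iota A) = a ^+ n.+1 *: w.
Proof.
rewrite map_char_poly -eigenvalue_root_char => /eigenvalueP[V VT V0].
pose W (i : 'I_n.+1) : 'rV[L]_m := submxrow V i.
have VE : V = \mxrow_i W i by rewrite submxrowK.
move: VT; rewrite map_tsr_mx {1 2}VE mul_mxrow_mxblock => VT.
have Wj (j : 'I_n.+1) : \sum_i (W i *m (if j.+1 == n.+1 then iota (c i) *: map_mx iota A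
      else if i == j.+1 :> nat then 1%:M else 0 : 'M[L]_m)) = a *: W j.
  have := congr1 (fun M => submxrow M j) VT; rewrite mxrowK => ->.
  by rewrite -VE; apply/matrixP => x y; rewrite !mxE.
have Wexp (i : 'I_n.+1) : W i = a ^+ i *: W ord0.
  case: i; elim=> [|i IHi] lt_i.
    by rewrite expr0 scale1r; congr W; apply: val_inj.
  (* Block column [i], not being the last, has an identity in row [i.+1] as its only nonzero
     block. *)
  have := Wj (Ordinal (ltnW lt_i)).
  rewrite (bigD1 (Ordinal lt_i)) //= ltn_eqF // eqxx mulmx1.
  rewrite big1 ?addr0 => [->|k]; first by rewrite IHi scalerA -exprS.
  by rewrite -val_eqE /= => /negPf->; rewrite mulmx0.
exists (W ord0).
  apply: contra V0 => /eqP W0; rewrite VE; apply/eqP.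
  apply/mxrowP => j; rewrite mxrowK Wexp W0 scaler0.
  by apply/matrixP=> x y; rewrite !mxE.
(* The last block column gives the relation involving [A]. *)
have := Wj ord_max; rewrite eqxx (Wexp ord_max) scalerA -exprS => <-.
rewrite scaler_suml; apply: eq_bigr => i _.
by rewrite (Wexp i) -scalemxAl -scalemxAr scalerA mulrC.
Qed.

End Eigen.

(** If [c ord0] vanished, the first block row would be zero, so ['X] would divide an irreducible
    polynomial of degree at least 2. *)
Lemma tsr_mx_coef0_neq0 (F : finFieldType) m n (c : {ffun 'I_n.+1 -> F})
    (A : 'M[F]_m) : (1 < m)%N ->
  irreducible_poly (char_poly (tsr_mx c A)) -> c ord0 != 0.
Proof.
move=> m1 irr; apply/eqP => c0.
have szT : (2 < size (char_poly (tsr_mx c A)))%N.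
  by rewrite size_char_poly ltnS sum_nat_const card_ord mulSn ltn_addr.
have : root (char_poly (tsr_mx c A)) 0.
  rewrite -eigenvalue_root_char; apply/eigenvalueP.
  pose W (i : 'I_n.+1) : 'rV[F]_m := if i == ord0 then const_mx 1 else 0.
  exists (\mxrow_i W i); last first.
    apply/eqP => /(congr1 (fun M => submxrow M ord0)) /rowP /(_ (Ordinal m1)).
    by rewrite mxrowK !mxE /= => /eqP; rewrite oner_eq0.
  rewrite mul_mxrow_mxblock scale0r; apply/mxrowP => j.
  rewrite mxrowK (bigD1 ord0) //= big1 => [|i i0]; last by rewrite /W (negPf i0) mul0mx.
  rewrite c0 scale0r if_same mulmx0 addr0.
  by apply/matrixP => x y; rewrite !mxE.
rewrite -dvdp_XsubCl subr0 => dX.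
have [_ /(_ 'X)] := irr; rewrite size_polyX => /(_ isT dX)/eqp_size.
by rewrite size_polyX => E; rewrite -E in szT.
Qed.

(** * The tower of fields generated by an eigenvalue, and what it determines *)

Section Extension.
Variables (F : finFieldType) (L : fieldExtType F) (m n : nat).
Variables (c : {ffun 'I_n.+1 -> F}) (A : 'M[F]_m) (z : L).
Hypothesis m_gt1 : (1 < m)%N.
Hypothesis dimL : \dim {:L} = (n.+1 * m)%N.
Hypothesis genL : <<1; z>>%VS = fullv.
Hypothesis rootz : root (map_poly (in_alg L) (char_poly (tsr_mx c A))) z.

Let g := \poly_(i < n.+1) (c (inord i))%:A : {poly L}.

(** The degree of [b] over [F] is at most [m] and that of [z] over [F(b)] at most [n.+1]; their
    product is [\dim {:L}], so both bounds are attained. *)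
Lemma tsr_mx_generator : exists b : L,
  [/\ b != 0, z ^+ n.+1 = b * g.[z], \dim <<1; b>> = m,
      adjoin_degree <<1; b>> z = n.+1
    & map_poly (in_alg L) (char_poly A) = minPoly 1 b].
Proof.
have z0 : z != 0.
  apply/eqP => z0; move: dimL; rewrite -genL z0 Fadjoin0 dimv1 => /eqP.
  by rewrite eq_sym muln_eq1 => /andP[_ /eqP m1]; move: m_gt1; rewrite m1.
have [w w0] := tsr_mx_eigen rootz.
have -> : \sum_i in_alg L (c i) * z ^+ i = g.[z].
  by rewrite horner_poly; apply: eq_bigr => i _; rewrite inord_val.
move=> wA.
have gz0 : g.[z] != 0.
  apply: contra w0 => /eqP gz; move/esym/eqP: wA.
  by rewrite gz scale0r scaler_eq0 expf_eq0 (negPf z0) andbF.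
pose b := z ^+ n.+1 / g.[z]; exists b.
have zb : z ^+ n.+1 = b * g.[z] by rewrite divfK.
have rb : root (map_poly (in_alg L) (char_poly A)) b.
  rewrite map_char_poly -eigenvalue_root_char; apply/eigenvalueP.
  exists w => //; apply: (scalerI gz0).
  by rewrite wA scalerA zb mulrC.
set fA := map_poly _ _ in rb *.
have fA1 : fA \is a polyOver 1%VS by exact: alg_polyOver.
have szfA : size fA = m.+1 by rewrite size_map_poly size_char_poly.
have fA0 : fA != 0 by rewrite -size_poly_eq0 szfA.
have minfA := minPoly_dvdp fA1 rb.
have degb : (adjoin_degree 1 b <= m)%N.
  by have := dvdp_leq fA0 minfA; rewrite size_minPoly szfA ltnS.
(* As [g] has degree at most [n], [p] has degree exactly [n.+1]; it bounds the degree of [z] over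
   [F(b)]. *)
pose p := 'X^(n.+1) - b *: g.
have szp : size p = n.+2.
  rewrite size_polyDl size_polyXn // size_polyN.
  by rewrite ltnS (leq_trans (size_scale_leq _ _)) // size_poly.
have p0 : p != 0 by rewrite -size_poly_eq0 szp.
have pK : p \is a polyOver <<1; b>>%VS.
  rewrite rpredB ?polyOverXn // polyOverZ ?memv_adjoin //.
  apply/polyOverP => i; rewrite coef_poly.
  by case: ifP => _; rewrite ?rpred0 // memvZ // mem1v.
have rp : root p z.
  by rewrite /root !hornerE zb subrr.
have degz : (adjoin_degree <<1; b>> z <= n.+1)%N.
  by have := dvdp_leq p0 (minPoly_dvdp pK rp); rewrite size_minPoly szp ltnS.
have dimb : \dim <<1; b>> = adjoin_degree 1 b by rewrite dim_Fadjoin dimv1 muln1.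
have full : <<<<1; b>>; z>>%VS = fullv.
  apply/eqP; rewrite eqEsubv subvf -genL; apply/FadjoinP; rewrite memv_adjoin.
  by rewrite (subv_trans (sub1v _) (subv_adjoin _ _)).
have := dim_Fadjoin <<1; b>> z; rewrite full dimL dimb => dE.
have m0 : (0 < m)%N by exact: ltnW.
have degbE : adjoin_degree 1 b = m.
  apply/eqP; rewrite eqn_leq degb -(leq_pmul2l (ltn0Sn n)) dE.
  by rewrite leq_mul2r degz orbT.
split=> //.
- by apply: contraNneq z0 => b0; move/eqP: zb; rewrite b0 mul0r expf_eq0.
- by move/eqP: dE; rewrite degbE eqn_pmul2r // => /eqP.
apply/eqP; rewrite -eqp_monic ?monic_minPoly ?map_monic ?char_poly_monic //.
by rewrite eqp_sym -dvdp_size_eqp // size_minPoly degbE szfA.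
Qed.

End Extension.

Lemma tsr_mx_splitting (F : finFieldType) m n (c : {ffun 'I_n.+1 -> F})
    (A : 'M[F]_m) : irreducible_poly (char_poly (tsr_mx c A)) ->
  exists (L : fieldExtType F) (z : L), [/\ \dim {:L} = (n.+1 * m)%N,
    <<1; z>>%VS = fullv & root (map_poly (in_alg L) (char_poly (tsr_mx c A))) z].
Proof.
move=> /irredp_FAdjoin[L dimL [z rz genL]]; exists L, z; split=> //.
by rewrite dimL size_char_poly /= sum_nat_const card_ord.
Qed.

(** Over [L] this polynomial becomes the minimal polynomial of [b] over [F]. *)
Lemma tsr_mx_irreducible_block (F : finFieldType) m n
    (c : {ffun 'I_n.+1 -> F}) (A : 'M[F]_m) : (1 < m)%N ->
  irreducible_poly (char_poly (tsr_mx c A)) -> irreducible_poly (char_poly A).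
Proof.
move=> m1 /tsr_mx_splitting[L [z [dimL genL rz]]].
have [b [_ _ _ _ fA]] := tsr_mx_generator m1 dimL genL rz.
split=> [|p p1 pA]; first by rewrite size_char_poly ltnS ltnW.
rewrite -(eqp_map (in_alg L)) fA.
have := @minPoly_irr _ _ 1%AS b (map_poly (in_alg L) p).
rewrite -fA dvdp_map => /(_ (alg_polyOver _ _) pA)/orP[//|].
by rewrite -size_poly_eq1 size_map_poly (negPf p1).
Qed.

Lemma tsr_mx_char_poly_inj (F : finFieldType) m n
    (c c' : {ffun 'I_n.+1 -> F}) (A A' : 'M[F]_m) : (1 < m)%N ->
  c ord0 = 1 -> c' ord0 = 1 -> irreducible_poly (char_poly (tsr_mx c A)) ->
  char_poly (tsr_mx c A) = char_poly (tsr_mx c' A') ->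
  c = c' /\ char_poly A = char_poly A'.
Proof.
move=> m1 c0 c'0 /tsr_mx_splitting[L [z [dimL genL rz]]] eqT.
have [b [b0 zb dimb degz fA]] := tsr_mx_generator m1 dimL genL rz.
rewrite eqT in rz.
have [b' [_ zb' dimb' _ fA']] := tsr_mx_generator m1 dimL genL rz.
(* Both subfields have dimension [m], so each is the set of fixed points of the same power map. *)
have b'K : b' \in <<1; b>>%VS.
  have := memv_adjoin 1 b'; rewrite !Fermat's_little_theorem.
  by rewrite /= dimb dimb'.
pose g (e : {ffun 'I_n.+1 -> F}) : {poly L} := \poly_(i < n.+1) (e (inord i))%:A.
have gK e x : x \in <<1; b>>%VS -> x *: g e \is a polyOver <<1; b>>%VS.
  move=> xK; rewrite polyOverZ //; apply/polyOverP => i; rewrite coef_poly.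
  by case: ifP => _; rewrite ?rpred0 // memvZ // mem1v.
have size_g e x : (size (x *: g e) <= n.+1)%N.
  by rewrite (leq_trans (size_scale_leq _ _)) // size_poly.
(* This polynomial over [F(b)] vanishes at [z] but has degree at most [n], below the degree [n.+1]
   of [z] over [F(b)]. *)
have : b *: g c - b' *: g c' == 0.
  rewrite -(root_small_adjoin_poly (K := <<1; b>>%AS) (x := z)).
  - by rewrite /root !hornerE -zb zb' subrr.
  - by rewrite rpredB ?gK ?memv_adjoin.
  by rewrite degz (leq_trans (size_polyD _ _)) // size_polyN geq_max !size_g.
rewrite subr_eq0 => /eqP/polyP eqg.
(* Compare constant coefficients, where the normalisation of [c] and [c'] enters. *)
have bb' : b = b'.
  have := eqg 0; rewrite !coefZ !coef_poly /=.
  have -> : inord 0 = ord0 :> 'I_n.+1 by apply: val_inj; rewrite /= inordK.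
  by rewrite c0 c'0 scale1r !mulr1.
split.
  apply/ffunP => i; apply: (fmorph_inj (in_alg L)); apply: (mulfI b0).
  by have := eqg i; rewrite -bb' !coefZ !coef_poly ltn_ord inord_val.
by apply: (map_poly_inj (in_alg L)); rewrite fA fA' bb'.
Qed.

(** * Fibres of the characteristic polynomial map, and the final count *)

Lemma TSRP_fiber (F : finFieldType) m n (T0 : 'M[F]_(\sum_(i < n.+1) m)) :
  (1 < m)%N -> T0 \in TSRP m n.+1 F ->
  #|[set T in TSRP m n.+1 F | char_poly T == char_poly T0]| =
  (\prod_(1 <= i < m) (#|F| ^ m - #|F| ^ i))%N.
Proof.
case: m T0 => [//|m] T0.
have normal T : (1 < m.+1)%N -> T \in TSRP m.+1 n.+1 F ->
    exists (c : {ffun 'I_n.+1 -> F}) (A : 'M[F]_m.+1),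
      [/\ T = tsr_mx c A, c ord0 = 1 & irreducible_poly (char_poly T)].
  move=> m1; rewrite inE => /andP[/existsP[c /existsP[A /eqP ->]]].
  move=> /primitive_polyP[[irr _] _ _].
  have c0 := tsr_mx_coef0_neq0 m1 irr.
  exists [ffun i => c i / c ord0], (c ord0 *: A).
  by rewrite tsr_mx_scale // ffunE divff.
move=> m1 T0P; have [c [A0 [T0E c0 irr]]] := normal T0 m1 T0P.
have irrA0 : irreducible_poly (char_poly A0).
  by apply: (@tsr_mx_irreducible_block _ _ _ c _ m1); rewrite -T0E.
rewrite -(card_char_poly_class irrA0).
(* With [c ord0 = 1] the top right block is [A] itself, so this map is injective. *)
rewrite -(card_imset _ (f := fun A => tsr_mx c A)); last first.
  move=> A A'; rewrite /tsr_mx => /eq_mxblockP/(_ ord0 ord_max).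
  by rewrite eqxx c0 !scale1r.
congr #|pred_of_set _|; apply/setP => T; rewrite inE.
apply/andP/imsetP => [[TP /eqP TT0]|[A]].
  have [c' [A [TE c'0 irrT]]] := normal T m1 TP.
  have irrT0 : irreducible_poly (char_poly (tsr_mx c A0)) by rewrite -T0E.
  have eqT : char_poly (tsr_mx c A0) = char_poly (tsr_mx c' A).
    by rewrite -T0E -TE TT0.
  have [cc' AA'] := tsr_mx_char_poly_inj m1 c0 c'0 irrT0 eqT.
  by exists A; rewrite ?inE ?AA' ?TE ?cc'.
rewrite inE => /eqP AA0 ->.
(* Primitivity depends only on the characteristic polynomial, so it carries over from [T0]. *)
suff TT0 : char_poly (tsr_mx c A) = char_poly T0.
  move: T0P; rewrite !inE TT0 => /andP[_ ->]; rewrite eqxx andbT; split=> //.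
  by apply/existsP; exists c; apply/existsP; exists A.
have e0 : const_mx 1 != 0 :> 'rV[F]_m.+1.
  by apply/eqP => /rowP/(_ ord0)/eqP; rewrite !mxE oner_eq0.
have [Q [Qu _ QA]] := char_poly_eq_conj irrA0 AA0 e0 e0.
by rewrite T0E (char_poly_tsr_conj c Qu QA).
Qed.

Theorem theorem3p2 (F : finFieldType) (q m n : nat)
    (card_F : #|F| = q) (q_ge3 : (3 <= q)%N) (m_ge2 : (2 <= m)%N)
    (n_odd : odd n) :
  #|TSRP m n F| =
    (#|` PsiP (TSRP m n F)| * \prod_(1 <= i < m) (q ^ m - q ^ i))%N.
Proof.
case: n n_odd => // n _; rewrite -card_F -sum1_card.
set S := TSRP m n.+1 F; set P := PsiP S.
(* Double counting: each [T] matches exactly one [p]; after exchanging the sums, each [p]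
   contributes the size of its fibre. *)
transitivity (\sum_(T in S) \sum_(p <- P) (char_poly T == p))%N.
  apply: eq_bigr => T TS.
  have TP : char_poly T \in P by apply: in_imfset.
  rewrite (big_fsetD1 _ TP) /= eqxx big_seq big1 // => p.
  by rewrite in_fsetD1 eq_sym => /andP[/negPf->].
rewrite exchange_big /= big_seq card_fset_sum1 big_distrl /= [RHS]big_seq.
apply: eq_bigr => p /imfsetP[T0 /= T0S ->]; rewrite mul1n.
rewrite -(TSRP_fiber m_ge2 T0S) -sum1_card.
rewrite [RHS](eq_bigl (fun T => (T \in S) && (char_poly T == char_poly T0))).
  by rewrite [RHS]big_mkcondr; apply: eq_bigr => T _; case: eqP.
by move=> T; rewrite inE.
Qed.
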